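(* For $\delta>0$ let $\Phi^\delta:=\Psi+\Phi_{diag}^\delta$ be a function on $\mathcal M_{N,K}$, where $\Psi:\mathcal M_{N,K}\to[0,\infty)$ is any real analytic function that does not depend on the parameter $\delta$. Let $G\in\mathcal M_{N,K}$ have no zero entries and suppose $\nabla\Phi^\delta(G)=0$ for all $\delta\in I$, where $I\subseteq(0,\infty)$ is an open interval. Then $G$ is the Gram matrix of an equal-norm Parseval frame.
   Context: Let $\mathbb F=\mathbb R$ or $\mathbb C$ and let $1\le K\le N$ be integers. $\mathcal M_{N,K}=\{G\in\mathbb F^{N\times N}: G=G^2=G^*,\ \mathrm{tr}(G)=K\}$ is precisely the set of Gram matrices $G=(\langle f_l,f_j\rangle)_{j,l=1}^N$ of Parseval frames $\{f_j\}_{j=1}^N$ for $\mathbb F^K$ (families with $\sum_j|\langle x,f_j\rangle|^2=\|x\|^2$ for all $x$); the frame is equal-norm if all $\|f_j\|$ are equal, i.e. all diagonal entries of $G$ are equal. $\mathcal M_{N,K}$ is regarded as a real analytic submanifold of the Hermitian (resp. symmetric) matrices with the Riemannian metric $X\cdot Y=\mathrm{tr}(XY)$; $\nabla$ is the corresponding Riemannian gradient on $\mathcal M_{N,K}$. The diagonal potential is $\Phi_{diag}^\delta(G)=\frac1\delta\sum_{j=1}^N e^{\delta|G_{j,j}|^2}-\frac N\delta e^{\delta K^2/N^2}$. Open intervals are nonempty. *)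

(* Defs.v *)
From HB Require Import structures.
From mathcomp Require Import all_boot all_order all_algebra.
From mathcomp Require Import complex.
From mathcomp Require Import all_classical all_reals all_analysis.

Set Implicit Arguments.
Unset Strict Implicit.
Unset Printing Implicit Defensive.

Import Order.TTheory GRing.Theory Num.Theory.
Import numFieldNormedType.Exports.

Local Open Scope classical_set_scope.
Local Open Scope ring_scope.

(* The field F is [scalarF R k], which is R for [k = FReal] and R[i] for
   [k = FComplex]. *)
Inductive field_kind := FReal | FComplex.

Definition scalarF (R : realType) (k : field_kind) : numFieldType :=
  match k with FReal => R | FComplex => R[i] end.

Section scalars.
Variables (R : realType) (k : field_kind).

Definition reF : scalarF R k -> R :=
  match k return scalarF R k -> R with
  | FReal => fun x => x
  | FComplex => fun z => complex.Re z
  end.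

Definition imF : scalarF R k -> R :=
  match k return scalarF R k -> R with
  | FReal => fun=> 0
  | FComplex => fun z => complex.Im z
  end.

Definition conjF : scalarF R k -> scalarF R k :=
  match k return scalarF R k -> scalarF R k with
  | FReal => fun x => x
  | FComplex => fun z => conjc z
  end.

(* The norm of a numFieldType takes its values in the field itself; the modulus
   is the same number seen in R. *)
Definition modulus (x : scalarF R k) : R := reF `|x|.

End scalars.

Section frames.
Variables (R : realType) (k : field_kind) (N K : nat).
Local Notation F := (scalarF R k).

Definition dot (x y : 'cV[F]_K) : F := \sum_i x i 0 * conjF (y i 0).

Definition vnorm (x : 'cV[F]_K) : R := Num.sqrt (reF (dot x x)).

Definition parseval_frame (f : 'I_N -> 'cV[F]_K) : Prop :=
  forall x, \sum_j modulus (dot x (f j)) ^+ 2 = vnorm x ^+ 2.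

Definition equal_norm (f : 'I_N -> 'cV[F]_K) : Prop :=
  forall j l, vnorm (f j) = vnorm (f l).

Definition gram (f : 'I_N -> 'cV[F]_K) : 'M[F]_N :=
  \matrix_(j, l) dot (f l) (f j).

End frames.

Section manifold.
Variables (R : realType) (k : field_kind) (N : nat).
Local Notation F := (scalarF R k).

Definition adjoint (G : 'M[F]_N) : 'M[F]_N := (map_mx (@conjF R k) G)^T.

Definition gram_manifold (K : nat) : set 'M[F]_N :=
  [set G | [/\ G = G *m G, G = adjoint G & \tr G = K%:R]].

(* Real coordinates on F^(N x N): real parts (b = false) and imaginary parts
   (b = true) of the entries.  For F = R the latter are all zero. *)
Definition rcoord (A : 'M[F]_N) (e : 'I_N * 'I_N * bool) : R :=
  let: (i, j, b) := e in if b then imF (A i j) else reF (A i j).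

Definition monomial (a : {ffun 'I_N * 'I_N * bool -> nat}) (H : 'M[F]_N) : R :=
  \prod_e rcoord H e ^+ a e.

(* f is real analytic on the embedded submanifold M: around each point P of M it
   is the restriction to M of an absolutely convergent power series in the
   ambient real coordinates.  The two extended sums are the sums of the positive
   and of the negative parts of the terms.  Only the values of f on M matter. *)
Definition real_analytic_on (M : set 'M[F]_N) (f : 'M[F]_N -> R) : Prop :=
  forall P, M P ->
  exists c : {ffun 'I_N * 'I_N * bool -> nat} -> R, exists2 r : R, 0 < r &
  forall H : 'M[F]_N, (forall e, `|rcoord H e| < r) ->
    let u := fun a => (c a * monomial a H)%:E in
    summable [set: {ffun 'I_N * 'I_N * bool -> nat}] u /\
    (M (P + H) ->
     (f (P + H))%:E =
       (\esum_(a in [set: {ffun 'I_N * 'I_N * bool -> nat}]) u^\+%E a -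
        \esum_(a in [set: {ffun 'I_N * 'I_N * bool -> nat}]) u^\-%E a)%E).

Definition smooth_curve_in (M : set 'M[F]_N) (g : R -> 'M[F]_N) : Prop :=
  (forall t, M (g t)) /\
  forall e n t, derivable (derive1n n (fun s : R => rcoord (g s) e)) t 1.

Definition has_velocity (g : R -> 'M[F]_N) (t : R) (V : 'M[F]_N) : Prop :=
  forall e, is_derive t 1 (fun s : R => rcoord (g s) e) (rcoord V e).

Definition tangent (M : set 'M[F]_N) (G X : 'M[F]_N) : Prop :=
  exists g, [/\ smooth_curve_in M g, g 0 = G & has_velocity g 0 X].

(* tr (X Y) is real when X and Y are self-adjoint, as tangent vectors to
   gram_manifold are. *)
Definition metric (X Y : 'M[F]_N) : R := reF (\tr (X *m Y)).

(* X is the Riemannian gradient of f at G: it is tangent and represents the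
   differential of f, i.e. df_G(Y) = metric X Y for every tangent vector Y,
   where df_G(g'(0)) = (f o g)'(0). *)
Definition is_gradient (M : set 'M[F]_N) (f : 'M[F]_N -> R) (G X : 'M[F]_N)
    : Prop :=
  tangent M G X /\
  forall g Y, smooth_curve_in M g -> g 0 = G -> has_velocity g 0 Y ->
    is_derive (0 : R) 1 (fun t : R => f (g t)) (metric X Y).

Definition Phi_diag (K : nat) (delta : R) (G : 'M[F]_N) : R :=
  delta^-1 * (\sum_(j < N) expR (delta * modulus (G j j) ^+ 2))
  - N%:R / delta * expR (delta * (K%:R ^+ 2 / N%:R ^+ 2)).

End manifold.

(* Main.v *)
Require Import Defs.
From HB Require Import structures.
From mathcomp Require Import all_boot all_order all_fingroup all_algebra.
From mathcomp Require Import complex ring lra.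
From mathcomp Require Import all_classical all_reals all_analysis.

(** Why the theorem is true.  The differential of [Psi] at [G] does not depend
    on [delta], so a gradient that vanishes for two values of [delta] gives,
    along every curve through [G], the same derivative of the diagonal potential
    for both values.  The curves that detect an unequal diagonal are conjugations
    of [G] by rotations in one coordinate plane.

    For [i != j] let [a] be the phase of [G i j], and rotate the coordinate plane
    of [i] and [j] through the angle [t], with off-diagonal coefficients
    [a sin t] and [- a^* sin t].  Conjugation by this unitary keeps [G] on the
    manifold, and among the diagonal entries it changes only those at [i] and
    [j], which move at [t = 0] with the opposite velocities [2 m] and [- 2 m],
    where [m = |G i j|].  With [x = G i i] and [y = G j j] the diagonal potential has
    therefore the derivative
      [4 m (x exp (delta x^2) - y exp (delta y^2))]
    ([is_derive_Phi_diag]), and this quantity has the same value for two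
    parameters [delta] ([critical_derive_Psi]).  Since [m != 0], the bracket
    itself has the same value for both.  Both [x] and [y] are positive because
    [G i i] is the sum of the [|G i l|^2], and the increment of
    [u exp (delta u^2)] between two fixed values of [delta > 0] is strictly
    increasing in [u > 0]; hence [x = y] ([exp_gap_inj]).

    So [G] has a constant diagonal.  A self-adjoint projection of trace [K]
    factors as [W^* W] with [W W^* = 1] ([proj_factor]); the columns of [W] form
    a Parseval frame with Gram matrix [G], whose squared norms are the diagonal
    entries of [G] ([equal_norm_frame]). *)

Import Order.TTheory GRing.Theory Num.Theory.
Import numFieldNormedType.Exports.
Local Open Scope classical_set_scope.
Local Open Scope ring_scope.

(** * Scalars *)

Section scalars.
Context {R : realType} {k : field_kind}.
Local Notation F := (scalarF R k).
Local Notation re := (@reF R k).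
Local Notation im := (@imF R k).
Local Notation conj := (@conjF R k).
Implicit Types (x y : F) (r : R).

Definition ofR : R -> F :=
  match k return R -> scalarF R k with
  | FReal => fun r => r
  | FComplex => fun r => r%:C%C
  end.

Lemma eqF x y : re x = re y -> im x = im y -> x = y.
Proof.
rewrite /reF /imF; case: k x y => //= -[a b] [c d] /=.
by move=> -> ->.
Qed.

Lemma reF_is_additive : zmod_morphism re.
Proof. by rewrite /reF; case: k => //= -[a b] [c d]. Qed.
HB.instance Definition _ := GRing.isZmodMorphism.Build F R re reF_is_additive.

Lemma imF_is_additive : zmod_morphism im.
Proof. by rewrite /imF; case: k => [x y|[a b] [c d]] //=; rewrite subr0. Qed.
HB.instance Definition _ := GRing.isZmodMorphism.Build F R im imF_is_additive.

Lemma reFM x y : re (x * y) = re x * re y - im x * im y.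
Proof.
rewrite /reF /imF; case: k x y => [x y|[a b] [c d]] //=.
by rewrite mulr0 subr0.
Qed.

Lemma imFM x y : im (x * y) = re x * im y + im x * re y.
Proof.
rewrite /reF /imF; case: k x y => [x y|[a b] [c d]] //=.
by rewrite mulr0 mul0r addr0.
Qed.

Lemma reF1 : re 1 = 1. Proof. by rewrite /reF; case: k. Qed.
Lemma imF1 : im 1 = 0. Proof. by rewrite /imF; case: k. Qed.
Lemma reF_conj x : re (conj x) = re x.
Proof. by rewrite /reF /conjF; case: k x => //= -[]. Qed.
Lemma imF_conj x : im (conj x) = - im x.
Proof. by rewrite /imF /conjF; case: k x => [x|[]] //=; rewrite oppr0. Qed.
Lemma reF_ofR r : re (ofR r) = r. Proof. by rewrite /reF /ofR; case: k. Qed.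
Lemma imF_ofR r : im (ofR r) = 0. Proof. by rewrite /imF /ofR; case: k. Qed.

(** These instances of the generic additivity lemmas exist for rewriting: the
    generic ones leave [re] and [im] packed as morphisms, and then the other
    rules of [reimE] no longer match. *)
Lemma reF0 : re 0 = 0. Proof. exact: raddf0. Qed.
Lemma imF0 : im 0 = 0. Proof. exact: raddf0. Qed.
Lemma reFD x y : re (x + y) = re x + re y. Proof. exact: raddfD. Qed.
Lemma imFD x y : im (x + y) = im x + im y. Proof. exact: raddfD. Qed.
Lemma reFN x : re (- x) = - re x. Proof. exact: raddfN. Qed.
Lemma imFN x : im (- x) = - im x. Proof. exact: raddfN. Qed.
Lemma reF_sum J (r : seq J) (P : pred J) (f : J -> F) :
  re (\sum_(i <- r | P i) f i) = \sum_(i <- r | P i) re (f i).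
Proof. exact: raddf_sum. Qed.

Definition reimE := (reFM, imFM, reF_conj, imF_conj, reF_ofR, imF_ofR, reF1, imF1,
  reF0, imF0, reFD, imFD, reFN, imFN).

Lemma conjF_is_additive : zmod_morphism conj.
Proof. by move=> x y; apply: eqF; rewrite !reimE //; ring. Qed.
HB.instance Definition _ := GRing.isZmodMorphism.Build F F conj conjF_is_additive.

Lemma conjF_is_multiplicative : monoid_morphism conj.
Proof.
by split=> [|x y]; apply: eqF; rewrite !reimE ?oppr0 //; ring.
Qed.
HB.instance Definition _ :=
  GRing.isMonoidMorphism.Build F F conj conjF_is_multiplicative.

Lemma ofR_is_additive : zmod_morphism ofR.
Proof. by move=> x y; apply: eqF; rewrite !reimE //; ring. Qed.
HB.instance Definition _ := GRing.isZmodMorphism.Build R F ofR ofR_is_additive.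

Lemma ofR_is_multiplicative : monoid_morphism ofR.
Proof. by split=> [|x y]; apply: eqF; rewrite !reimE //; ring. Qed.
HB.instance Definition _ :=
  GRing.isMonoidMorphism.Build R F ofR ofR_is_multiplicative.

Lemma conjFK : involutive conj.
Proof. by move=> x; apply: eqF; rewrite !reimE ?opprK. Qed.

Lemma conj_ofR r : conj (ofR r) = ofR r.
Proof. by apply: eqF; rewrite !reimE ?oppr0. Qed.

Lemma conj_fixed x : conj x = x -> x = ofR (re x).
Proof.
move=> cx; apply: eqF; rewrite !reimE //.
by have := congr1 im cx; rewrite !reimE; lra.
Qed.

Lemma modulus_sqr x : modulus x ^+ 2 = re x ^+ 2 + im x ^+ 2.
Proof.
rewrite /modulus /reF /imF; case: k x => [x|[a b]] /=.
  by rewrite real_normK ?num_real// expr0n addr0.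
rewrite -[LHS]/(Num.sqrt (a ^+ 2 + b ^+ 2) ^+ 2).
by rewrite sqr_sqrtr // addr_ge0 ?sqr_ge0.
Qed.

Lemma mul_conj x : x * conj x = ofR (modulus x ^+ 2).
Proof. by apply: eqF; rewrite modulus_sqr !reimE; ring. Qed.

Lemma modulus_ofR r : modulus (ofR r) ^+ 2 = r ^+ 2.
Proof. by rewrite modulus_sqr !reimE expr0n addr0. Qed.

Lemma modulus_eq0 x : (modulus x ^+ 2 == 0) = (x == 0).
Proof.
apply/idP/eqP => [|->]; last by rewrite modulus_sqr !reimE expr0n addr0.
rewrite modulus_sqr paddr_eq0 ?sqr_ge0 // !sqrf_eq0 => /andP[/eqP a /eqP b].
by apply: eqF; rewrite reimE.
Qed.

End scalars.

(** * Projections as Gram matrices *)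

Section adjoint.
Context {R : realType} {k : field_kind}.
Local Notation F := (scalarF R k).

(** On square matrices this is [adjoint] by conversion; the factorization of a
    projection needs it on rectangular ones. *)
Definition adj {m n} (A : 'M[F]_(m, n)) : 'M[F]_(n, m) :=
  (map_mx (@conjF R k) A)^T.

Lemma adjE m n (A : 'M[F]_(m, n)) i j : adj A i j = conjF (A j i).
Proof. by rewrite !mxE. Qed.

Lemma adjM m n p (A : 'M[F]_(m, n)) (B : 'M[F]_(n, p)) :
  adj (A *m B) = adj B *m adj A.
Proof. by rewrite /adj map_mxM trmx_mul. Qed.

Lemma adjK m n (A : 'M[F]_(m, n)) : adj (adj A) = A.
Proof. by apply/matrixP => i j; rewrite !adjE conjFK. Qed.

Lemma adjB m n (A B : 'M[F]_(m, n)) : adj (A - B) = adj A - adj B.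
Proof. by rewrite /adj map_mxB linearB. Qed.

Lemma mul_adj_diag m n (A : 'M[F]_(m, n)) i :
  (A *m adj A) i i = ofR (\sum_j modulus (A i j) ^+ 2).
Proof.
rewrite mxE rmorph_sum; apply: eq_bigr => j _.
by rewrite adjE mul_conj.
Qed.

Section projection.
Context {N : nat}.

(** The diagonal of [G = G *m adj G]: it consists of nonnegative reals, and a
    zero on it forces its whole row to vanish. *)
Lemma proj_diag {G : 'M[F]_N} (GG : G = G *m G) (Ga : G = adjoint G) i :
  G i i = ofR (\sum_j modulus (G i j) ^+ 2).
Proof. by rewrite [in LHS]GG {2}Ga mul_adj_diag. Qed.

(** Induction on the trace.  A nonzero row of [G], normalized to [w], satisfies
    [w G = w], so [G - w^* w] is again a projection, of trace one less; it
    annihilates [w], which makes [w] orthogonal to the rows of its factor. *)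
Lemma proj_factor K (G : 'M[F]_N) : gram_manifold K G ->
  exists2 W : 'M[F]_(K, N), W *m adj W = 1%:M & G = adj W *m W.
Proof.
elim: K G => [|K IH] G [GG Ga trG].
  exists 0; first by apply/matrixP => -[].
  apply/matrixP => i j; rewrite mulmx0 [RHS]mxE; apply/eqP.
  rewrite -modulus_eq0.
  (* The trace of a projection is the sum of all squared moduli. *)
  have: \sum_i \sum_j modulus (G i j) ^+ 2 = 0.
    rewrite -[RHS](reF0 (k := k)) -[0 in RHS]/(0%:R) -trG reF_sum.
    apply: eq_bigr => l _.
    by rewrite (proj_diag GG Ga) reF_ofR.
  move/eqP; rewrite psumr_eq0 => [/allP/(_ i)|l _]; last first.
    by apply: sumr_ge0 => *; apply: sqr_ge0.
  rewrite mem_index_enum => /(_ isT) /=.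
  rewrite psumr_eq0 => [/allP/(_ j)|l _]; last by apply: sqr_ge0.
  by rewrite mem_index_enum => /(_ isT).
have [i Gi] : exists i, G i i != 0.
  apply/existsP; apply: contraT; rewrite negb_exists => /forallP G0.
  have /eqP := trG; rewrite /mxtrace big1 => [|i _]; last exact/eqP/negPn/G0.
  by rewrite eq_sym pnatr_eq0.
pose d := \sum_j modulus (G i j) ^+ 2.
have Gd : G i i = ofR d by rewrite (proj_diag GG Ga).
have d_gt0 : 0 < d.
  rewrite lt_def sumr_ge0 ?andbT => [|*]; last exact: sqr_ge0.
  by apply: contraNneq Gi => d0; rewrite Gd d0 raddf0.
pose s := (Num.sqrt d)^-1.
have sd : s * (s * d) = 1.
  rewrite mulrA -invfM -expr2 sqr_sqrtr ?ltW // mulVf //.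
  by rewrite gt_eqF.
pose w : 'rV[F]_N := ofR s *: row i G.
have ww : w *m adj w = 1%:M.
  apply/matrixP => p q; rewrite !ord1 mul_adj_diag [RHS]mxE /=.
  rewrite -[RHS](rmorph1 ofR); congr ofR; rewrite -sd mulrA mulr_sumr.
  apply: eq_bigr => j _; rewrite !mxE !modulus_sqr !reimE; ring.
have wG : w *m G = w by rewrite -scalemxAl -row_mul -GG.
have Gw : G *m adj w = adj w by rewrite {1}Ga -[adjoint G]/(adj G) -adjM wG.
have wwG : adj w *m w *m G = adj w *m w by rewrite -mulmxA wG.
have Gww : G *m (adj w *m w) = adj w *m w by rewrite mulmxA Gw.
have wwww : adj w *m w *m (adj w *m w) = adj w *m w.
  by rewrite mulmxA -[adj w *m w *m _]mulmxA ww mulmx1.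
pose G' := G - adj w *m w.
have [W WW GW] : exists2 W : 'M[F]_(K, N), W *m adj W = 1%:M & G' = adj W *m W.
  apply: IH; split.
  - by rewrite mulmxBl !mulmxBr -GG wwG Gww wwww subrr subr0.
  - by rewrite -[adjoint _]/(adj _) adjB adjM adjK -[adj G]/(adjoint G) -Ga.
  - rewrite raddfB /= trG (mxtrace_mulC (adj w)) ww mxtrace1.
    by rewrite -natrB // subSS subn0.
have wG' : w *m G' = 0 by rewrite mulmxBr wG mulmxA ww mul1mx subrr.
have wW : w *m adj W = 0.
  have : w *m G' *m adj W = 0 by rewrite wG' mul0mx.
  by rewrite GW -!mulmxA WW mulmx1.
have adjW : adj (col_mx w W) = row_mx (adj w) (adj W).
  by rewrite /adj map_col_mx tr_col_mx.
rewrite -[K.+1]/(1 + K)%N; exists (col_mx w W); last first.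
  by rewrite adjW mul_row_col -GW /G' addrC subrK.
rewrite adjW mul_col_row ww WW wW.
have -> : W *m adj w = 0 by rewrite -[LHS]adjK adjM adjK wW /adj map_mx0 trmx0.
by rewrite -(scalar_mx_block 1 K 1).
Qed.

(** The Parseval identity for the columns of [W] is [W *m adj W = 1] read on the
    vector [adj W *m x] of the frame coefficients of [x]. *)
Lemma equal_norm_frame K (G : 'M[F]_N) : gram_manifold K G ->
  (forall i j, G i i = G j j) ->
  exists f : 'I_N -> 'cV[F]_K, [/\ parseval_frame f, equal_norm f & G = gram f].
Proof.
move=> /proj_factor[W WW GW] Gd.
have GWf : G = gram (fun l => col l W).
  apply/matrixP => j l; rewrite GW !mxE; apply: eq_bigr => i _.
  by rewrite adjE !mxE mulrC.
exists (fun l => col l W); split=> //.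
- move=> x.
  have xx : dot x x = ofR (\sum_i modulus (x i 0) ^+ 2).
    by rewrite rmorph_sum; apply: eq_bigr => i _; rewrite mul_conj.
  rewrite /vnorm sqr_sqrtr; last first.
    by rewrite xx reF_ofR sumr_ge0 // => *; apply: sqr_ge0.
  pose y := adj W *m x.
  have <- : (adj y *m y) 0 0 = dot x x.
    rewrite /y adjM adjK mulmxA -[_ *m W *m _]mulmxA WW mulmx1 mxE.
    by apply: eq_bigr => i _; rewrite adjE mulrC.
  rewrite -{2}[y]adjK mul_adj_diag reF_ofR; apply: eq_bigr => j _.
  rewrite adjE !modulus_sqr !reimE sqrrN /y !mxE /dot.
  by under eq_bigr do rewrite mxE mulrC -adjE.
- move=> j l; rewrite /vnorm; congr (Num.sqrt (reF _)).
  by have := Gd j l; rewrite GWf !mxE.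
Qed.

End projection.
End adjoint.

(** * Rotations in a coordinate plane *)

Section rotation.
Context {R : realType} {k : field_kind} {N : nat}.
Local Notation F := (scalarF R k).
Context {i j : 'I_N} (ij : i != j) {a : F} (a1 : a * conjF a = 1).

(** Row [p] of the rotation is supported on [p] and on its partner
    [tperm i j p]: [rot_diag] is the coefficient at [p] and [rot_off] the one at
    the partner.  For [p] outside the plane the two positions coincide, with
    coefficients 1 and 0, so one formula covers all entries. *)
Definition rot_diag (c : R) (p : 'I_N) : F :=
  if (p == i) || (p == j) then ofR c else 1.

Definition rot_off (s : R) (p : 'I_N) : F :=
  if p == i then ofR s * a else if p == j then - (ofR s * conjF a) else 0.

Definition rot (c s : R) : 'M[F]_N :=
  \matrix_(p, q) (rot_diag c p * (p == q)%:R
                  + rot_off s p * (tperm i j p == q)%:R).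

Lemma mul_rot c s (A : 'M[F]_N) p q :
  (rot c s *m A) p q = rot_diag c p * A p q + rot_off s p * A (tperm i j p) q.
Proof.
have sel (x : F) r : \sum_l x * (r == l)%:R * A l q = x * A r q.
  rewrite (bigD1 r) //= eqxx mulr1 big1 ?addr0 // => l lr.
  by rewrite eq_sym (negPf lr) mulr0 mul0r.
rewrite mxE -!sel -big_split; apply: eq_bigr => l _.
by rewrite mxE mulrDl.
Qed.

Lemma mul_adj_rot c s (A : 'M[F]_N) p q :
  (A *m adj (rot c s)) p q =
  conjF (rot_diag c q) * A p q + conjF (rot_off s q) * A p (tperm i j q).
Proof.
rewrite -{1}[A]adjK -adjM [LHS]adjE mul_rot rmorphD !rmorphM /=.
by rewrite !adjE !conjFK.
Qed.

Lemma rot_conj c s (A : 'M[F]_N) p q :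
  (rot c s *m A *m adj (rot c s)) p q =
  conjF (rot_diag c q) * (rot_diag c p * A p q + rot_off s p * A (tperm i j p) q)
  + conjF (rot_off s q) * (rot_diag c p * A p (tperm i j q)
                           + rot_off s p * A (tperm i j p) (tperm i j q)).
Proof. by rewrite mul_adj_rot !mul_rot. Qed.

Lemma rot_unitary c s : c ^+ 2 + s ^+ 2 = 1 -> adj (rot c s) *m rot c s = 1%:M.
Proof.
move=> cs; apply: mulmx1C; rewrite -{1}[rot c s]mulmx1.
apply/matrixP => p q.
have csF : ofR c * ofR c = 1 - ofR s * ofR s :> F.
  by rewrite -!rmorphM -(rmorph1 ofR) -rmorphB /= -!expr2 -cs addrK.
rewrite rot_conj !mxE /rot_diag /rot_off.
have [/negPf Eij /negPf Eji] : i != j /\ j != i by rewrite ij eq_sym ij.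
case: (tpermP i j p) => [->|->|/eqP/negPf pi /eqP/negPf pj];
  case: (tpermP i j q) => [->|->|/eqP/negPf qi /eqP/negPf qj];
  rewrite ?[i == p]eq_sym ?[j == p]eq_sym ?[i == q]eq_sym ?[j == q]eq_sym
    ?pi ?pj ?qi ?qj ?eqxx ?Eij ?Eji /=
    ?(rmorph1, rmorph0, rmorphN, rmorphM, conj_ofR, conjFK) /=
    ?(conj_ofR, conjFK) ?(mulr0, mul0r, addr0, add0r, mulr1, mul1r) //.
all: ring: csF a1.
Qed.

End rotation.
Arguments rot {R k N} i j a c s.

(** * Trigonometric polynomials *)

Section trigpoly.
Context {R : realType}.

(** A class of functions closed under differentiation, so that all its members
    are infinitely differentiable, and containing the real coordinates of the
    rotated matrices. *)
Inductive trigpoly : (R -> R) -> Prop :=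
| trig_cst c : trigpoly (fun=> c)
| trig_cos : trigpoly cos
| trig_sin : trigpoly sin
| trig_add f g : trigpoly f -> trigpoly g -> trigpoly (fun t => f t + g t)
| trig_mul f g : trigpoly f -> trigpoly g -> trigpoly (fun t => f t * g t).

Lemma trig_opp f : trigpoly f -> trigpoly (fun t => - f t).
Proof.
move=> Tf; have -> : (fun t => - f t) = (fun t => -1 * f t).
  by apply/funext => t; rewrite mulN1r.
exact/trig_mul/Tf/trig_cst.
Qed.

Lemma trig_derive f : trigpoly f ->
  (forall t, derivable f t 1) /\ trigpoly (derive1 f).
Proof.
suff H : trigpoly f -> exists2 g, trigpoly g & forall t : R, is_derive t 1 f (g t).
  move=> /H[g Tg fg]; split=> [t|]; first by have [] := fg t.
  suff -> : derive1 f = g by [].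
  by apply/funext => t; rewrite derive1E; apply: derive_val.
elim=> [c|||{}f g _ [f' Tf' f'E] Tg [g' Tg' g'E]|
            {}f g Tf [f' Tf' f'E] Tg [g' Tg' g'E]].
- by exists (fun=> 0) => [|t]; [exact: trig_cst|exact: is_derive_cst].
- exists (fun t => - sin t) => [|t]; last exact: is_derive_cos.
  exact/trig_opp/trig_sin.
- by exists cos => [|t]; [exact: trig_cos|exact: is_derive_sin].
- by exists (fun t => f' t + g' t) => [|t]; [exact: trig_add|exact: is_deriveD].
- exists (fun t => f t * g' t + g t * f' t) => [|t]; last exact: is_deriveM.
  by apply: trig_add; apply: trig_mul.
Qed.

Lemma trig_smooth f n t : trigpoly f -> derivable (derive1n n f) t 1.
Proof.
move=> Tf; have [] // := @trig_derive (derive1n n f).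
elim: n => [|n IH]; first by rewrite derive1n0.
by rewrite derive1nS; have [] := trig_derive _ IH.
Qed.

Context {k : field_kind}.
Local Notation F := (scalarF R k).

Definition trigF (h : R -> F) :=
  trigpoly (fun t => reF (h t)) /\ trigpoly (fun t => imF (h t)).

Lemma trigF_cst x : trigF (fun=> x). Proof. by split; exact: trig_cst. Qed.

Lemma trigF_ofR f : trigpoly f -> trigF (fun t => ofR (f t)).
Proof.
move=> Tf; split; under eq_fun do rewrite reimE; first exact: Tf.
exact: trig_cst.
Qed.

Lemma trigF_opp h : trigF h -> trigF (fun t => - h t).
Proof.
by case=> hr hi; split; under eq_fun do rewrite reimE; apply: trig_opp.
Qed.

Lemma trigF_conj h : trigF h -> trigF (fun t => conjF (h t)).
Proof.
by case=> hr hi; split; under eq_fun do rewrite reimE; last exact: trig_opp.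
Qed.

Lemma trigF_add h l : trigF h -> trigF l -> trigF (fun t => h t + l t).
Proof.
by case=> hr hi [lr li]; split; under eq_fun do rewrite reimE; apply: trig_add.
Qed.

Lemma trigF_mul h l : trigF h -> trigF l -> trigF (fun t => h t * l t).
Proof.
case=> hr hi [lr li]; split; under eq_fun do rewrite reimE.
  by apply: trig_add; [|apply: trig_opp]; apply: trig_mul.
by apply: trig_add; apply: trig_mul.
Qed.

(** Over the reals the coordinate [imF] is identically zero, hence so is its
    derivative; this is why a pair of derivatives comes from one scalar. *)
Lemma trigF_velocity h : trigF h -> exists y : F,
  is_derive (0 : R) 1 (fun t => reF (h t)) (reF y) /\
  is_derive (0 : R) 1 (fun t => imF (h t)) (imF y).
Proof.
case=> /trig_derive [dr _] /trig_derive [di _]; move: h dr di.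
rewrite /reF /imF; case: k => h dr di.
  exists ('D_1 h 0); split; last exact: is_derive_cst.
  exact/derivableP.
exists (complex.Complex ('D_1 (fun t => complex.Re (h t)) 0)
                        ('D_1 (fun t => complex.Im (h t)) 0)).
by split; apply/derivableP.
Qed.

End trigpoly.

(** * The rotation curve *)

Section curve.
Context {R : realType} {k : field_kind} {N K : nat}.
Local Notation F := (scalarF R k).
Context {i j : 'I_N} (ij : i != j) {a : F} (a1 : a * conjF a = 1).
Context {G : 'M[F]_N} (hG : gram_manifold K G).

Definition rot_curve (t : R) : 'M[F]_N :=
  rot i j a (cos t) (sin t) *m G *m adj (rot i j a (cos t) (sin t)).

Lemma rot_curve_in t : gram_manifold K (rot_curve t).
Proof.
have [GG Ga trG] := hG.
have UU := rot_unitary ij a1 _ _ (cos2Dsin2 t).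
rewrite /rot_curve; set U := rot _ _ _ _ _ in UU *; split.
- by rewrite !mulmxA -[_ *m U]mulmxA UU mulmx1 -[_ *m G *m G]mulmxA -GG.
- rewrite -[adjoint _]/(adj _) !adjM adjK mulmxA; congr (_ *m _ *m _).
  exact: Ga.
- by rewrite mxtrace_mulC mulmxA UU mul1mx.
Qed.

Lemma rot_curve0 : rot_curve 0 = G.
Proof.
apply/matrixP => p q; rewrite /rot_curve rot_conj cos0 sin0.
rewrite /rot_diag /rot_off !raddf0 !rmorph1 !mul0r oppr0 !if_same.
by rewrite raddf0 rmorph1 !mul0r !addr0 !mul1r.
Qed.

Lemma rot_curve_trig p q : trigF (fun t => rot_curve t p q).
Proof.
have Td x : trigF (fun t => @rot_diag _ k N i j (cos t) x).
  rewrite /rot_diag; case: (_ || _); last exact: trigF_cst.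
  exact/trigF_ofR/trig_cos.
have To x : trigF (fun t => @rot_off _ k N i j a (sin t) x).
  have Ts := trigF_ofR (k := k) _ trig_sin.
  rewrite /rot_off; case: (x == i); last case: (x == j); last exact: trigF_cst.
  - exact/trigF_mul/trigF_cst.
  - exact/trigF_opp/trigF_mul/trigF_cst.
rewrite /rot_curve; under eq_fun do rewrite rot_conj.
have C := @trigF_cst R k.
by apply: trigF_add; apply: trigF_mul; do ?[exact: trigF_conj];
  apply: trigF_add; apply: trigF_mul.
Qed.

Lemma rot_curve_rcoord e : trigpoly (fun t => rcoord (rot_curve t) e).
Proof. by case: e => [[p q] []]; have [] := rot_curve_trig p q. Qed.

Lemma rot_curve_smooth : smooth_curve_in (gram_manifold K) rot_curve.
Proof.
split=> [|e n t]; first exact: rot_curve_in.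
exact/trig_smooth/rot_curve_rcoord.
Qed.

Lemma rot_curve_velocity : exists Y, has_velocity rot_curve 0 Y.
Proof.
have H (pq : 'I_N * 'I_N) : exists y : F,
    is_derive (0 : R) 1 (fun t => reF (rot_curve t pq.1 pq.2)) (reF y) /\
    is_derive (0 : R) 1 (fun t => imF (rot_curve t pq.1 pq.2)) (imF y).
  exact/trigF_velocity/rot_curve_trig.
have [Y YE] := boolp.choice H.
exists (\matrix_(p, q) Y (p, q)) => -[[p q] b].
by have [Yr Yi] := YE (p, q); case: b; rewrite /rcoord mxE.
Qed.

(** The identity [a a^* = 1] in the shape that [ring] uses as a rewrite rule. *)
Let ar : reF a * reF a = 1 - imF a * imF a.
Proof. by have := congr1 (@reF R k) a1; rewrite !reimE => <-; ring. Qed.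

Let Gij p q : G p q = conjF (G q p).
Proof. by have [_ Ga _] := hG; rewrite {1}Ga -[adjoint G]/(adj G) adjE. Qed.

Let Gii p : imF (G p p) = 0.
Proof. by have /conj_fixed -> := esym (Gij p p); rewrite reimE. Qed.

Lemma rot_curve_diag_i t : rot_curve t i i =
  ofR (cos t ^+ 2 * reF (G i i) + sin t ^+ 2 * reF (G j j)
       + 2 * cos t * sin t * reF (conjF a * G i j)).
Proof.
rewrite /rot_curve rot_conj tpermL /rot_diag /rot_off eqxx /= (Gij j i).
by apply: eqF; rewrite !reimE ?Gii; ring: ar.
Qed.

Lemma rot_curve_diag_j t : rot_curve t j j =
  ofR (cos t ^+ 2 * reF (G j j) + sin t ^+ 2 * reF (G i i)
       - 2 * cos t * sin t * reF (conjF a * G i j)).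
Proof.
rewrite /rot_curve rot_conj tpermR /rot_diag /rot_off eqxx orbT (Gij j i).
rewrite eq_sym (negPf ij).
by apply: eqF; rewrite !reimE ?Gii; ring: ar.
Qed.

Lemma rot_curve_diag p t : p != i -> p != j -> rot_curve t p p = G p p.
Proof.
move=> /negPf pi /negPf pj; rewrite /rot_curve rot_conj /rot_diag /rot_off pi pj /=.
by rewrite rmorph1 raddf0 !mul0r !addr0 !mul1r.
Qed.

End curve.

(** * Derivatives of the potential *)

Section calculus.
Context {R : realType}.
Implicit Types (x y m d : R).

(** The equation says that the increments of [u exp (d u^2)] from [d1] to [d2]
    agree at [u = x] and [u = y].  The increment is the product
    [u exp (d1 u^2) (exp ((d2 - d1) u^2) - 1)], whose factors are nonnegative
    and strictly increasing in [u > 0]. *)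
Lemma exp_gap_inj x y d1 d2 : 0 < x -> 0 < y -> 0 < d1 -> d1 < d2 ->
  x * expR (d1 * x ^+ 2) - y * expR (d1 * y ^+ 2) =
  x * expR (d2 * x ^+ 2) - y * expR (d2 * y ^+ 2) -> x = y.
Proof.
move=> x0 y0 d10 d12 e.
have incr u v : 0 < u -> u < v ->
    u * expR (d2 * u ^+ 2) - u * expR (d1 * u ^+ 2) <
    v * expR (d2 * v ^+ 2) - v * expR (d1 * v ^+ 2).
  move=> u0 uv.
  have uv2 : u ^+ 2 < v ^+ 2 by rewrite ltr_pXn2r // ?nnegrE ?ltW // (lt_trans u0).
  have fac w : w * expR (d2 * w ^+ 2) - w * expR (d1 * w ^+ 2) =
      w * expR (d1 * w ^+ 2) * (expR ((d2 - d1) * w ^+ 2) - 1).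
    have -> : d2 * w ^+ 2 = d1 * w ^+ 2 + (d2 - d1) * w ^+ 2 by ring.
    by rewrite expRD; ring.
  have h0 : 0 < d2 - d1 by rewrite subr_gt0.
  rewrite !fac; apply: ltr_pM.
  - by rewrite mulr_ge0 ?expR_ge0 // ltW.
  - by rewrite subr_ge0 -expR0 ler_expR mulr_ge0 ?sqr_ge0 ?ltW.
  - by apply: ltr_pM; rewrite ?expR_ge0 ?ltW // ltr_expR ltr_pM2l.
  - by rewrite ltrD2r ltr_expR ltr_pM2l.
by case: (ltrgtP x y) => // /incr; [move/(_ x0)|move/(_ y0)]; lra.
Qed.

Lemma is_derive_rot x y m : is_derive (0 : R) 1
  (fun t => cos t ^+ 2 * x + sin t ^+ 2 * y + 2 * cos t * sin t * m) (2 * m).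
Proof.
have -> : (fun t => cos t ^+ 2 * x + sin t ^+ 2 * y + 2 * cos t * sin t * m) =
  (x *: (cos * cos) + y *: (sin * sin) + (2 * m) *: (cos * sin) : R -> R).
  apply/funext => t; rewrite -[RHS]/(x * (cos t * cos t) + y * (sin t * sin t)
    + 2 * m * (cos t * sin t)); ring.
apply: is_derive_eq.
by rewrite cos0 sin0 /GRing.scale /=; ring.
Qed.

Lemma is_derive_expsq d (P : R -> R) p : is_derive (0 : R) 1 P p ->
  is_derive (0 : R) 1 (fun t => expR (d * P t ^+ 2))
    (expR (d * P 0 ^+ 2) * (d * (2 * P 0 * p))).
Proof.
move=> dP.
have dQ : is_derive (0 : R) 1 (fun t => d * P t ^+ 2) (d * (2 * P 0 * p)).
  have -> : (fun t => d * P t ^+ 2) = d *: (P * P).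
    by apply/funext => t; rewrite expr2.
  apply: is_derive_eq; rewrite /GRing.scale /=; ring.
exact: (@is_derive1_comp R expR (fun t => d * P t ^+ 2) 0 _ _
  (is_derive_expR _) dQ).
Qed.

End calculus.

Section potential.
Context {R : realType} {k : field_kind} {N K : nat}.
Local Notation F := (scalarF R k).
Context {G : 'M[F]_N} (hG : gram_manifold K G).
Context {i j : 'I_N} (ij : i != j) {a : F} (a1 : a * conjF a = 1).
Local Notation x := (reF (G i i)).
Local Notation y := (reF (G j j)).
Local Notation m := (reF (conjF a * G i j)).
Local Notation g := (rot_curve (i := i) (j := j) (a := a) (G := G)).

Lemma is_derive_Phi_diag (d : R) : 0 < d ->
  is_derive (0 : R) 1 (fun t => Phi_diag K d (g t))
    (4 * m * (x * expR (d * x ^+ 2) - y * expR (d * y ^+ 2))).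
Proof.
move=> d0.
(* [P x y m] and [P y x (- m)] are the two diagonal entries that move. *)
pose P u v m' t := cos t ^+ 2 * u + sin t ^+ 2 * v + 2 * cos t * sin t * m' : R.
have P0 u v m' : P u v m' 0 = u by rewrite /P cos0 sin0; ring.
pose C := \sum_(l < N | (l != i) && (l != j)) expR (d * modulus (G l l) ^+ 2).
pose D := N%:R / d * expR (d * (K%:R ^+ 2 / N%:R ^+ 2)).
have -> : (fun t => Phi_diag K d (g t)) = fun t =>
    (d^-1 * expR (d * P x y m t ^+ 2) + d^-1 * expR (d * P y x (- m) t ^+ 2))
    + (d^-1 * C - D).
  apply/funext => t; rewrite /Phi_diag addrA -!mulrDr; congr (_ * _ - _).
  rewrite (bigD1 i) //= (bigD1 j) 1?eq_sym //= addrA.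
  rewrite (rot_curve_diag_i a1 hG) (rot_curve_diag_j ij a1 hG) !modulus_ofR.
  rewrite -mulrN; congr (_ + _).
  by apply: eq_bigr => l /andP[li lj]; rewrite rot_curve_diag.
have := is_derive_expsq d (P x y m) _ (is_derive_rot x y m).
have := is_derive_expsq d (P y x (- m)) _ (is_derive_rot y x (- m)).
rewrite !P0 => d2 d1.
apply: is_derive_eq (is_deriveD (is_deriveD (is_deriveZ d^-1 d1)
  (is_deriveZ d^-1 d2)) (is_derive_cst (d^-1 * C - D) (0 : R) (1 : R))) _.
rewrite /GRing.scale /=; field.
exact: lt0r_neq0.
Qed.

(** Subtracting the potential from the critical sum shows both that [Psi] is
    differentiable along the curve and what its derivative is.  The left-hand
    side does not involve [d], so the value cannot depend on [d] either. *)
Lemma critical_derive_Psi (Psi : 'M[F]_N -> R) (d : R) : 0 < d ->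
  is_gradient (gram_manifold K) (fun A => Psi A + Phi_diag K d A) G 0 ->
  is_derive (0 : R) 1 (fun t => Psi (g t))
    (- (4 * m * (x * expR (d * x ^+ 2) - y * expR (d * y ^+ 2)))).
Proof.
move=> d0 [_ grad0].
have [Y gY] := @rot_curve_velocity _ k _ i j a G.
have dPhi := grad0 _ Y (rot_curve_smooth ij a1 hG) rot_curve0 gY.
have -> : (fun t => Psi (g t)) =
    (fun t => Psi (g t) + Phi_diag K d (g t)) - (fun t => Phi_diag K d (g t)).
  by apply/funext => t; rewrite -[RHS]/(_ + _ - _) addrK.
apply: is_derive_eq (is_deriveB dPhi (is_derive_Phi_diag d d0)) _.
by rewrite /metric mul0mx mxtrace0 reF0 sub0r.
Qed.

End potential.

Theorem proposition4p15 (R : realType) (k : field_kind) (N K : nat)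
  (hK : (1 <= K)%N) (hKN : (K <= N)%N)
  (Psi : 'M[scalarF R k]_N -> R)
  (Psi_ge0 : forall A, gram_manifold K A -> 0 <= Psi A)
  (Psi_analytic : real_analytic_on (gram_manifold K) Psi)
  (G : 'M[scalarF R k]_N) (hG : gram_manifold K G)
  (G_nz : forall i j, G i j != 0)
  (I : set R) (I_open : open I) (I_itv : is_interval I) (I_n0 : I !=set0)
  (I_pos : I `<=` [set delta | 0 < delta])
  (hgrad : forall delta, I delta ->
    is_gradient (gram_manifold K) (fun A => Psi A + Phi_diag K delta A) G 0) :
  exists f : 'I_N -> 'cV[scalarF R k]_K,
    [/\ parseval_frame f, equal_norm f & G = gram f].
Proof.
apply: equal_norm_frame => // i j.
have [->//|ij] := eqVneq i j.
have [GG Ga _] := hG.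
have diag l : G l l = ofR (reF (G l l)) /\ 0 < reF (G l l).
  have Gll := proj_diag GG Ga l.
  have E : G l l = ofR (reF (G l l)) by rewrite Gll reF_ofR.
  split=> //; rewrite lt_def; apply/andP; split.
    by apply: contraNneq (G_nz l l) => z; rewrite E z raddf0.
  by rewrite Gll reF_ofR sumr_ge0 // => *; apply: sqr_ge0.
have [Gi xi] := diag i; have [Gj xj] := diag j; rewrite Gi Gj; congr ofR.
(* With the phase of [G i j] as [a], the velocity factor [conjF a * G i j] is
   the modulus [m], hence nonzero. *)
pose m := Num.sqrt (modulus (G i j) ^+ 2).
have m2 : m ^+ 2 = modulus (G i j) ^+ 2 by rewrite sqr_sqrtr ?sqr_ge0.
have m0 : m != 0 by rewrite -sqrf_eq0 m2 modulus_eq0.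
pose a := ofR m^-1 * G i j.
have a1 : a * conjF a = 1.
  rewrite /a rmorphM /= conj_ofR mulrACA mul_conj -m2 -!rmorphM -invfM /=.
  by rewrite -expr2 mulVf ?expf_neq0 // rmorph1.
have am : reF (conjF a * G i j) = m.
  rewrite /a rmorphM /= conj_ofR -mulrA [conjF _ * _]mulrC mul_conj -m2 -rmorphM.
  by rewrite /= reF_ofR expr2 mulKf.
have [d1 Id1] := I_n0.
have [d2 d12 Id2] : exists2 d2, d1 < d2 & I d2.
  have [/= e e0 eI] := I_open _ Id1.
  exists (d1 + e / 2); first by rewrite ltrDl divr_gt0.
  apply: eI; rewrite /= opprD addNKr normrN gtr0_norm ?divr_gt0 //.
  by rewrite ltr_pdivrMr // ltr_pMr // ltr1n.
have D d (Id : I d) := critical_derive_Psi hG ij a1 Psi d (I_pos _ Id) (hgrad _ Id).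
have := @derive_val _ _ _ _ _ _ _ (D d1 Id1).
rewrite (@derive_val _ _ _ _ _ _ _ (D d2 Id2)) am => /oppr_inj /mulfI e.
apply: (exp_gap_inj _ _ _ _ xi xj (I_pos _ Id1) d12).
by rewrite e // mulf_neq0 ?pnatr_eq0.
Qed.
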